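(* Suppose that the conditional distribution of $(X,H)$ given $Y=y$ is that of the mixed normal/Ising model described in the context. Let $$w(X,H)=\big(X^T,\ H^T,\ [\mathrm{vech}(HH^T)]^T\big)^T$$ and let $\alpha_c$ be a matrix whose columns form a basis of $$\mathrm{span}\begin{pmatrix}\Delta^{-1}A&0\\ -\beta^T\Delta^{-1}A&0\\ 0&\tau\end{pmatrix}.$$ Then $$R(X,H)=\alpha_c^T\big(w(X,H)-E(w(X,H))\big)$$ is a sufficient reduction for the regression of $Y$ on $(X,H)$.
   Context: Setting. $Y$ is a (continuous or categorical) random response, $X$ is a random vector in $\mathbb{R}^p$, $H$ a random vector in $\{0,1\}^q$, $Z=(X^T,H^T)^T$. $f_Y\in\mathbb{R}^r$ is a known function of $Y$, centered so that $E(f_Y)=0$. $\mathrm{vech}$ stacks the columns of the lower triangular part of a square matrix including the diagonal; $\mathrm{span}$ of a matrix means its column space. Model. Parameters: $\Delta$ a $p\times p$ positive definite matrix, $A\in\mathbb{R}^{p\times r}$, $\beta\in\mathbb{R}^{p\times q}$, $\mu_X=E(X)$, $\mu_H=E(H)$, $\tau_0\in\mathbb{R}^{q(q+1)/2}$, $\tau\in\mathbb{R}^{q(q+1)/2\times r}$. The conditional law of $(X,H)$ given $Y=y$ is: $X\mid(H,Y=y)\sim N(\mu_X+Af_y+\beta(H-\mu_H),\Delta)$ and $P(H=h\mid Y=y)=G_y^{-1}\exp\{\mathrm{vech}(hh^T)^T(\tau_0+\tau f_y)\}$ for $h\in\{0,1\}^q$, with $G_y=\sum_{h\in\{0,1\}^q}\exp\{\mathrm{vech}(hh^T)^T(\tau_0+\tau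 f_y)\}$. Definition. A function $R$ of $Z$ is a sufficient reduction for the regression of $Y$ on $Z$ if the conditional distribution of $Y$ given $Z$ equals that of $Y$ given $R(Z)$ (equivalently, $Z\mid(Y,R(Z))$ has the same distribution as $Z\mid R(Z)$). *)

(* Defs.v *)
(* Random vectors take values in the measurable types
   [n.-tuple R] and [n.-tuple bool]; they are turned into column vectors by
   [cvec] and [cvecb] for the matrix algebra. *)
From HB Require Import structures.
From mathcomp Require Import all_boot all_order all_algebra.
From mathcomp Require Import all_classical all_reals all_analysis.

Set Implicit Arguments.
Unset Strict Implicit.
Unset Printing Implicit Defensive.

Import Order.TTheory GRing.Theory Num.Theory.
Import numFieldNormedType.Exports.

Local Open Scope classical_set_scope.
Local Open Scope ring_scope.

Section LinearAlgebra.
Context {R : realType}.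

Definition cvec n (x : n.-tuple R) : 'cV[R]_n := \col_i tnth x i.

Definition cvecb n (h : n.-tuple bool) : 'cV[R]_n := \col_i (tnth h i)%:R.

Definition posdef n (D : 'M[R]_n) : Prop :=
  D^T = D /\ forall x : 'cV[R]_n, x != 0 -> 0 < (x^T *m D *m x) 0 0.

(* Column by column; in column j the rows i >= j are kept. *)
Definition vech_seq n (M : 'M[R]_n) : seq R :=
  [seq M i j | j <- enum 'I_n, i <- [seq i : 'I_n <- enum 'I_n | (j <= i)%N]].

Lemma size_vech_seq n (M : 'M[R]_n) : size (vech_seq M) = (n * n.+1)./2.
Proof.
rewrite /vech_seq size_allpairs_dep sumnE big_map big_enum /=.
rewrite (eq_bigr (fun j : 'I_n => (n - j)%N)); last first.
  move=> j _; rewrite size_filter -(count_map val (fun i => (j <= i)%N)).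
  rewrite val_enum_ord; move: (ltnW (ltn_ord j)); move: (nat_of_ord j) => k kn.
  have -> : iota 0 n = iota 0 k ++ iota k (n - k) by rewrite -iotaD subnKC.
  rewrite count_cat (_ : count _ (iota 0 k) = 0%N); last first.
    apply/eqP; rewrite eqn0Ngt -has_count; apply/hasPn => i.
    by rewrite mem_iota add0n -ltnNge => /andP[].
  rewrite add0n -[RHS](size_iota k (n - k)).
  by apply/eqP; rewrite -all_count; apply/allP => i; rewrite mem_iota => /andP[].
rewrite (reindex_inj rev_ord_inj) /=.
rewrite (eq_bigr (fun j : 'I_n => j.+1)); last first.
  by move=> j _; rewrite subKn.
rewrite -(big_mkord xpredT (fun i => i.+1)) -(big_add1 _ _ _ n.+1 xpredT id) /=.
have -> : (\sum_(1 <= i < n.+1) i = \sum_(0 <= i < n.+1) i)%N.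
  by rewrite [RHS]big_ltn.
by rewrite bin2_sum bin2 /= mulnC.
Qed.

Definition vech n (M : 'M[R]_n) : 'cV[R]_((n * n.+1)./2) :=
  \col_k (vech_seq M)`_k.

(* MathComp subspaces are row spaces, whence the transposes. *)
Definition cols_basis_of_span m d n (B : 'M[R]_(m, d)) (M : 'M[R]_(m, n)) :
  Prop := row_free B^T /\ (B^T :=: M^T)%MS.

End LinearAlgebra.

Lemma sigma_finite_measure_of d (T : measurableType d) (R : realType)
    (nu : {measure set T -> \bar R}) : sigma_finite setT nu ->
  exists mu : {sigma_finite_measure set T -> \bar R},
    nu = mu :> (set T -> \bar R).
Proof.
move=> nusf.
pose H1 := isSFinite.Build _ _ _ _ (sfinite_measure_sigma_finite nusf).
pose H2 := isSigmaFinite.Build _ _ _ _ nusf.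
pose mu := HB.pack_for {sigma_finite_measure set T -> \bar R}
  (Measure.sort nu) H1 H2.
by exists mu.
Qed.

Section LebesgueTuple.
Context (R : realType).

Definition tcons n (xt : R * n.-tuple R) : n.+1.-tuple R :=
  [the n.+1.-tuple R of xt.1 :: xt.2].

Lemma measurable_tcons n : measurable_fun setT (@tcons n).
Proof. exact: measurable_cons. Qed.

(* Lebesgue measure on R^n, as an iterated product. *)
Fixpoint lebesgue_tuple (n : nat) : set (n.-tuple R) -> \bar R :=
  match n return set (n.-tuple R) -> \bar R with
  | 0 => \d_([tuple] : 0.-tuple R)
  | m.+1 => pushforward (@lebesgue_measure R \x @lebesgue_tuple m)%E (@tcons m)
  end.
Arguments lebesgue_tuple n : clear implicits.

Lemma lebesgue_tuple_subdef n :
  exists mu : {sigma_finite_measure set (n.-tuple R) -> \bar R},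
    lebesgue_tuple n = mu :> (set (n.-tuple R) -> \bar R).
Proof.
elim: n => [|n [mu muE]] /=.
  by exists (\d_([tuple] : 0.-tuple R)).
rewrite muE.
pose nu : {measure set (n.+1.-tuple R) -> \bar R} :=
  @measure_function_pushforward__canonical__measure_function_Measure _ _ _ _ _
    (@lebesgue_measure R \x mu)%E (@tcons n) (@measurable_tcons n).
have nusf : sigma_finite setT nu.
  have /sigma_finiteP[F [FT ndF mF]] := sigma_finiteT (@lebesgue_measure R).
  have /sigma_finiteP[G [GT ndG mG]] := sigma_finiteT mu.
  pose g (t : n.+1.-tuple R) : R * n.-tuple R := (thead t, [tuple of behead t]).
  have mg : measurable_fun setT g.
    apply/measurable_fun_pairP; split; first exact: measurable_tnth.
    exact: measurable_behead.
  have tcK : cancel (@tcons n) g.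
    by case=> x t; rewrite /g /= theadE; congr pair; apply/val_inj.
  exists (fun k => g @^-1` (F k `*` G k)).
    apply/esym/seteqP; split=> // t _.
    have [i _ Fi] : (\bigcup_i F i) (thead t) by rewrite -FT.
    have [j _ Gj] : (\bigcup_i G i) [tuple of behead t] by rewrite -GT.
    exists (maxn i j) => //; split.
      by move: Fi; exact/subsetPset/ndF/leq_maxl.
    by move: Gj; exact/subsetPset/ndG/leq_maxr.
  move=> k; have [mFk Fk] := mF k; have [mGk Gk] := mG k; split.
    by rewrite -[X in measurable X]setTI; apply: mg => //; exact: measurableX.
  rewrite /nu /= /pushforward -comp_preimage.
  rewrite (_ : g \o @tcons n = id); last by apply/funext => x /=; exact: tcK.
  by rewrite preimage_id product_measure1E// lte_mul_pinfty// ge0_fin_numE.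
by have [nu' nuE] := sigma_finite_measure_of nusf; exists nu'; rewrite -nuE.
Qed.

Section Instances.
Variable n : nat.

Let lebesgue_tuple0 : lebesgue_tuple n set0 = 0%E.
Proof. by have [mu ->] := lebesgue_tuple_subdef n. Qed.

Let lebesgue_tuple_ge0 A : (0 <= lebesgue_tuple n A)%E.
Proof. by have [mu ->] := lebesgue_tuple_subdef n. Qed.

Let lebesgue_tuple_sigma_additive : semi_sigma_additive (lebesgue_tuple n).
Proof.
have [mu ->] := lebesgue_tuple_subdef n.
exact: measure_semi_sigma_additive.
Qed.

HB.instance Definition _ := isMeasure.Build _ _ _ (lebesgue_tuple n)
  lebesgue_tuple0 lebesgue_tuple_ge0 lebesgue_tuple_sigma_additive.

Let lebesgue_tuple_sigma_finite : sigma_finite setT (lebesgue_tuple n).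
Proof. by have [mu ->] := lebesgue_tuple_subdef n; exact: sigma_finiteT. Qed.

HB.instance Definition _ := Measure_isSigmaFinite.Build _ _ _
  (lebesgue_tuple n) lebesgue_tuple_sigma_finite.

End Instances.

End LebesgueTuple.
Arguments lebesgue_tuple R n _ : clear implicits.

Section Distributions.
Context {R : realType}.

Definition multinormal_pdf p (m : 'cV[R]_p) (D : 'M[R]_p) (x : p.-tuple R) : R :=
  (Num.sqrt ((2 * pi) ^+ p * \det D))^-1 *
  expR (- (((cvec x - m)^T *m invmx D *m (cvec x - m)) 0 0) / 2).

(* The law N(m, D), for D positive definite. *)
Definition multinormal p (m : 'cV[R]_p) (D : 'M[R]_p) (B : set (p.-tuple R)) :
  \bar R := (\int[lebesgue_tuple R p]_(x in B) (multinormal_pdf m D x)%:E)%E.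

Definition ising_weight q (theta : 'cV[R]_((q * q.+1)./2)) (h : q.-tuple bool) : R :=
  expR (((vech (cvecb h *m (cvecb h)^T))^T *m theta) 0 0).

Definition ising_pmf q (theta : 'cV[R]_((q * q.+1)./2)) (h : q.-tuple bool) : R :=
  ising_weight theta h / \sum_(g : q.-tuple bool) ising_weight theta g.

End Distributions.

Section ConditionalLaws.
Context {d : measure_display} {Omega : measurableType d} {R : realType}.
Variable P : probability Omega R.

(* K is a regular version of the conditional distribution of V given W. *)
Definition cond_dist dV dW (TV : measurableType dV) (TW : measurableType dW)
    (V : Omega -> TV) (W : Omega -> TW) (K : R.-pker TW ~> TV) : Prop :=
  forall (B : set TV) (C : set TW), measurable B -> measurable C ->
    P ((V @^-1` B) `&` (W @^-1` C)) = (\int[P]_(w in W @^-1` C) K (W w) B)%E.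

Definition sufficient_reduction dY dZ dS (TY : measurableType dY)
    (TZ : measurableType dZ) (TS : measurableType dS)
    (Y : Omega -> TY) (Z : Omega -> TZ) (S : TZ -> TS) : Prop :=
  measurable_fun setT S /\
  exists (KZ : R.-pker TZ ~> TY) (KS : R.-pker TS ~> TY),
    [/\ cond_dist Y Z KZ, cond_dist Y (S \o Z) KS &
        {ae P, forall w, forall B : set TY, measurable B ->
           KZ (Z w) B = KS (S (Z w)) B}].

End ConditionalLaws.

(* Centering f at the response and the equations for mu_X, mu_H force the
   corresponding integrals to converge: in the library the integral of a
   measurable function that is not integrable is infinite.  In mni_X and mni_H,
   K is the version of the conditional distribution given by the formulas for
   every value of the conditioning variable. *)
Record mixed_normal_ising (d dY : measure_display) (Omega : measurableType d)
    (TY : measurableType dY) (R : realType) (P : probability Omega R)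
    (p q r : nat)
    (Y : {RV P >-> TY}) (X : {RV P >-> p.-tuple R}) (H : {RV P >-> q.-tuple bool})
    (f : {mfun TY >-> r.-tuple R})
    (Delta : 'M[R]_p) (A : 'M[R]_(p, r)) (beta : 'M[R]_(p, q))
    (mu_X : 'cV[R]_p) (mu_H : 'cV[R]_q)
    (tau0 : 'cV[R]_((q * q.+1)./2)) (tau : 'M[R]_((q * q.+1)./2, r)) : Prop :=
  MixedNormalIsing {
    mni_posdef : posdef Delta ;
    mni_centered : forall i, ('E_P[fun w => tnth (f (Y w)) i] = 0)%E ;
    mni_mean_X : forall i, ('E_P[fun w => tnth (X w) i] = (mu_X i 0)%:E)%E ;
    mni_mean_H : forall i, ('E_P[fun w => (tnth (H w) i)%:R] = (mu_H i 0)%:E)%E ;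
    mni_X : exists2 K : R.-pker (q.-tuple bool * TY) ~> p.-tuple R,
      cond_dist P X (fun w => (H w, Y w)) K &
      forall h y B, measurable B ->
        K (h, y) B =
        multinormal (mu_X + A *m cvec (f y) + beta *m (cvecb h - mu_H)) Delta B ;
    mni_H : exists2 K : R.-pker TY ~> q.-tuple bool,
      cond_dist P H Y K &
      forall y h, K y [set h] = (ising_pmf (tau0 + tau *m cvec (f y)) h)%:E
  }.

Section Reduction.
Context {R : realType} {p q : nat}.

Definition wvec (z : p.-tuple R * q.-tuple bool) :
    'cV[R]_(p + (q + (q * q.+1)./2)) :=
  col_mx (cvec z.1)
    (col_mx (cvecb z.2) (vech (cvecb z.2 *m (cvecb z.2)^T))).

(* Its column space is the span of which alpha_c is a basis. *)
Definition red_mx r (Delta : 'M[R]_p) (A : 'M[R]_(p, r)) (beta : 'M[R]_(p, q))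
    (tau : 'M[R]_((q * q.+1)./2, r)) :
    'M[R]_(p + (q + (q * q.+1)./2), r + r) :=
  col_mx (row_mx (invmx Delta *m A) 0)
    (col_mx (row_mx (- (beta^T *m invmx Delta *m A)) 0)
            (row_mx 0 tau)).

Definition expectation_cV (d : measure_display) (Omega : measurableType d)
    (P : probability Omega R) m (W : Omega -> 'cV[R]_m) : 'cV[R]_m :=
  \col_i fine ('E_P[fun w => (W w i 0)%R])%E.

Definition reduction m (alpha : 'M[R]_(p + (q + (q * q.+1)./2), m))
    (Ew : 'cV[R]_(p + (q + (q * q.+1)./2))) (z : p.-tuple R * q.-tuple bool) :
    m.-tuple R :=
  [tuple (alpha^T *m (wvec z - Ew)) i 0 | i < m].

End Reduction.

(* Main.v *)
(* The joint law of (X, H, Y) has density pdf * pmf with respect to the product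
   of Lebesgue measure, counting measure and the law of Y. Writing
   u = x - mu_X - beta (h - mu_H), the exponent of this density is a function of
   (x, h), plus a function of y, plus the bilinear term
   f_y^T (A^T Delta^-1 u + tau^T vech(h h^T)), which depends on (x, h) only
   through red_mx^T w(x, h), hence only through the reduction because alpha_c
   spans the columns of red_mx. The density therefore factors as
   a(z) t(S z, y), and by Bayes' rule a(z) cancels in the law of Y given Z = z. *)
Require Import Defs.
From HB Require Import structures.
From mathcomp Require Import all_boot all_order all_algebra.
From mathcomp Require Import all_classical all_reals all_analysis.
From mathcomp Require Import measurable_realfun.
From mathcomp Require Import ring.

Set Implicit Arguments.
Unset Strict Implicit.
Unset Printing Implicit Defensive.

Import Order.TTheory GRing.Theory Num.Theory.
Import numFieldNormedType.Exports.

Local Open Scope classical_set_scope.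
Local Open Scope ring_scope.

(** * Integration against a measure given by a density *)

Section Density.
Context d (T : measurableType d) (R : realType).
Variables (mu nu : {measure set T -> \bar R}) (g : T -> \bar R).
Hypothesis mg : measurable_fun setT g.
Hypothesis g0 : forall x, (0 <= g x)%E.
Hypothesis nuE :
  forall A, measurable A -> nu A = (\int[mu]_(x in A) g x)%E.

Import HBNNSimple.
Local Open Scope ereal_scope.

Let integral_density_indic (E : set T) (r : R) : measurable E -> (0 <= r)%R ->
  \int[nu]_x (r * \1_E x)%:E = \int[mu]_x ((r * \1_E x)%:E * g x).
Proof.
move=> mE r0.
under eq_integral do rewrite EFinM.
rewrite ge0_integralZl//; last by apply/measurable_EFinP.
rewrite integral_indic// setIT nuE//.
under [RHS]eq_integral do rewrite EFinM -muleA.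
rewrite ge0_integralZl//; last 2 first.
- by apply: emeasurable_funM => //; exact/measurable_EFinP.
- by move=> x _; rewrite mule_ge0.
rewrite integral_mkcond; congr (_ * _); apply: eq_integral => x _.
by rewrite patchE indicE; case: ifPn; rewrite ?mul1e ?mul0e.
Qed.

Let integral_density_nnsfun (h : {nnsfun T >-> R}) :
  \int[nu]_x (h x)%:E = \int[mu]_x ((h x)%:E * g x).
Proof.
under eq_integral do rewrite fimfunE -fsumEFin//.
rewrite ge0_integral_fsum//; last 2 first.
- by move=> r; exact/measurable_EFinP/measurableT_comp.
- by move=> r x _; rewrite EFinM nnfun_muleindic_ge0.
under [RHS]eq_integral => x _.
  rewrite fimfunE -fsumEFin// ge0_mule_fsuml; last first.
    by move=> r; rewrite EFinM nnfun_muleindic_ge0.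
  over.
rewrite /= ge0_integral_fsum//; last 2 first.
- move=> r; apply: emeasurable_funM => //.
  exact/measurable_EFinP/measurableT_comp.
- by move=> r x _; rewrite mule_ge0// EFinM nnfun_muleindic_ge0.
apply: eq_fsbigr => r _.
have [r0|r0] := leP 0%R r; first exact: integral_density_indic.
by rewrite !integral0_eq// => x _; rewrite preimage_nnfun0// indic0 mulr0 ?mul0e.
Qed.

(** The standard ladder: indicators, then nonnegative simple functions, then monotone convergence.
    The density may take the value +oo, so the limit of the products needs a separate argument at
    such points. *)
Lemma ge0_integral_density (D : set T) (f : T -> \bar R) : measurable D ->
    measurable_fun setT f -> (forall x, 0 <= f x) ->
  \int[nu]_(x in D) f x = \int[mu]_(x in D) (f x * g x).
Proof.
move=> mD mf f0; pose fD := f \_ D.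
have mfD : measurable_fun setT fD.
  by apply/(measurable_restrictT f) => //; exact: measurable_funTS.
have fD0 x : 0 <= fD x by rewrite /fD patchE; case: ifP.
rewrite integral_mkcond [RHS]integral_mkcond -/fD.
transitivity (\int[mu]_x (fD x * g x)); last first.
  by apply: eq_integral => x _; rewrite /fD !patchE; case: ifP; rewrite ?mul0e.
pose f_ := nnsfun_approx measurableT mfD.
transitivity (limn (fun n => \int[nu]_x (f_ n x)%:E)).
  rewrite -monotone_convergence//.
  - by apply: eq_integral => y _; apply/esym/cvg_lim => //; exact: cvg_nnsfun_approx.
  - by move=> n; exact/measurable_EFinP.
  - by move=> n y _; rewrite lee_fin.
  - by move=> y _ m n mn; rewrite lee_fin; exact/lefP/nd_nnsfun_approx.
under eq_fun do rewrite integral_density_nnsfun.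
rewrite -monotone_convergence//.
- apply: eq_integral => x _; apply/cvg_lim => //.
  have cvf : (f_ n x)%:E @[n --> \oo] --> fD x by exact: cvg_nnsfun_approx.
  have [gfin|] := boolP (g x \is a fin_num); first exact: cvgeZr.
  (* Where [g x] is infinite, either [fD x] is 0 and every approximation below it vanishes too, or
     [fD x] is nonzero and the product of the limits is well defined. *)
  rewrite ge0_fin_numE// -leNgt leye_eq => /eqP gy.
  have [fDx0|fDx0] := eqVneq (fD x) 0.
    rewrite fDx0 mul0e (_ : (fun n => _) = cst 0); first exact: cvg_cst.
    apply/funext => n; suff -> : f_ n x = 0%R by rewrite mul0e.
    apply/eqP; rewrite eq_le [X in _ && X]fun_ge0 andbT -lee_fin.
    have := @le_approx _ _ _ setT fD n x (fun y _ => fD0 y) Logic.I.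
    by rewrite fDx0 nnsfun_approxE.
  apply: (@cvgeM _ _ _ _ (fun n => (f_ n x)%:E) (fun=> g x)) => //.
    by apply: neq0_mule_def; rewrite gy mule_eq0 negb_or fDx0.
  exact: cvg_cst.
- move=> n; apply: emeasurable_funM => //; exact/measurable_EFinP.
- by move=> n x _; rewrite mule_ge0// lee_fin.
- move=> x _ m n mn; rewrite lee_wpmul2r// lee_fin.
  exact/lefP/nd_nnsfun_approx.
Qed.

End Density.

(** * Kernels obtained from a density and by precomposition *)

Section KernelDensity.
Context dX dY (X : measurableType dX) (Y : measurableType dY) (R : realType).
Variables (mu : {sigma_finite_measure set Y -> \bar R}) (t : X * Y -> \bar R).
Hypothesis mt : measurable_fun setT t.
Hypothesis t0 : forall z, (0 <= t z)%E.

Local Open Scope ereal_scope.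

Definition partial_integral (x : X) (B : set Y) : \bar R := \int[mu]_(y in B) t (x, y).

Let mtx x : measurable_fun setT (fun y => t (x, y)).
Proof. exact: measurableT_comp. Qed.

Let partial_integral0 x : partial_integral x set0 = 0.
Proof. exact: integral_set0. Qed.

Let partial_integral_ge0 x B : 0 <= partial_integral x B.
Proof. by apply: integral_ge0 => y _. Qed.

Let partial_integral_sigma_additive x : semi_sigma_additive (partial_integral x).
Proof. exact: semi_sigma_additive_nng_induced. Qed.

HB.instance Definition _ x := isMeasure.Build _ _ _ (partial_integral x)
  (partial_integral0 x) (partial_integral_ge0 x) (@partial_integral_sigma_additive x).

(* The measure structure of [partial_integral] depends on [mt] and [t0], which
   its term does not mention; [kdensity] carries them. *)
Definition kdensity (x : X) : {measure set Y -> \bar R} := partial_integral x.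

Let measurable_kdensity B : measurable B -> measurable_fun setT (kdensity ^~ B).
Proof.
move=> mB; rewrite (_ : kdensity ^~ B =
    fubini_F mu (fun z => t z * (\1_B z.2)%:E)); last first.
  apply/funext => x; rewrite /kdensity /= /partial_integral integral_mkcond.
  apply: eq_integral => y _; rewrite patchE indicE.
  by case: ifPn; rewrite ?mule1 ?mule0.
apply: measurable_fun_fubini_tonelli_F.
- apply: emeasurable_funM => //.
  by apply/measurable_EFinP; exact: measurableT_comp.
- by move=> z; rewrite mule_ge0.
Qed.

HB.instance Definition _ :=
  isKernel.Build _ _ _ _ _ kdensity measurable_kdensity.

End KernelDensity.

Section KernelPrecomposition.
Context dX dY dW (X : measurableType dX) (Y : measurableType dY)
  (W : measurableType dW) (R : realType).
Variables (k : R.-pker Y ~> W) (f : X -> Y).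

(** The argument [mf] makes the term carry the measurability proof from which its kernel structure
    is inferred. *)
Definition kprecomp (mf : measurable_fun setT f) (x : X) :
  {measure set W -> \bar R} := k (f x).

Variable mf : measurable_fun setT f.

Let measurable_kprecomp B :
  measurable B -> measurable_fun setT (kprecomp mf ^~ B).
Proof. by move=> mB; exact: measurableT_comp (measurable_kernel k B mB) mf. Qed.

HB.instance Definition _ :=
  isKernel.Build _ _ _ _ _ (kprecomp mf) measurable_kprecomp.

Let kprecomp_setT x : kprecomp mf x setT = 1%E.
Proof. exact: prob_kernel. Qed.

HB.instance Definition _ :=
  @Kernel_isProbability.Build _ _ _ _ _ (kprecomp mf) kprecomp_setT.

End KernelPrecomposition.

(** * A factorization criterion for sufficiency *)

Section Factorization.
Context d dY dZ dS (Omega : measurableType d) (TY : measurableType dY)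
  (TZ : measurableType dZ) (TS : measurableType dS) (R : realType).
Variables (P : probability Omega R) (Y : {RV P >-> TY}) (Z : Omega -> TZ).
Variables (zeta : {measure set TZ -> \bar R}) (S : TZ -> TS).
Variables (a : TZ -> \bar R) (t : TS * TY -> \bar R).
Hypotheses (mZ : measurable_fun setT Z) (mS : measurable_fun setT S).
Hypotheses (ma : measurable_fun setT a) (a0 : forall z, (0 <= a z)%E).
Hypotheses (mt : measurable_fun setT t) (t0 : forall u, (0 <= t u)%E).

Local Open Scope ereal_scope.

Hypothesis factorization : forall (B : set TY) (C : set TZ),
  measurable B -> measurable C ->
  P ((Y @^-1` B) `&` (Z @^-1` C)) =
  \int[zeta]_(z in C) (a z * \int[distribution P Y]_(y in B) t (S z, y)).

(** Bayes' rule. With k s B the integral of t (s, y) over B against the law of [Y], the law of [Z]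
    has density a(z) k (S z) setT with respect to [zeta]. The factor a(z) cancels in the posterior k
    (S z) B / k (S z) setT, which depends on z only through S z; so one kernel serves both for [Z]
    (precomposed with [S]) and for [S \o Z]. *)
Lemma factorization_sufficient_reduction : sufficient_reduction P Y Z S.
Proof.
pose k : R.-ker TS ~> TY := kdensity (distribution P Y) mt t0.
(* The law of [Y] is the fallback value where the mass of [k] is 0 or +oo; any probability would
   do. *)
pose KS : R.-pker TS ~> TY := knormalize k (distribution P Y).
have mk B : measurable B -> measurable_fun setT (fun z => k (S z) B).
  by move=> mB; apply: (measurableT_comp (measurable_kernel k B mB)).
have mKS B : measurable B -> measurable_fun setT (fun z => KS (S z) B).
  by move=> mB; apply: (measurableT_comp (measurable_kernel KS B mB)).
pose g z := a z * k (S z) setT.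
have mg : measurable_fun setT g by apply: emeasurable_funM => //; exact: mk.
have g0 z : 0 <= g z by rewrite mule_ge0.
have gE C : measurable C -> pushforward P Z C = \int[zeta]_(z in C) g z.
  by move=> mC; rewrite -factorization// preimage_setT setTI.
(* The density [g] has total integral 1, hence is finite almost everywhere; this controls the points
   where the mass of [k] is infinite. *)
have g_lty : {ae zeta, forall z, g z < +oo}.
  have ig : zeta.-integrable setT g.
    apply/integrableP; split => //.
    under eq_integral do rewrite gee0_abs//.
    by rewrite -gE// /pushforward preimage_setT probability_setT ltry.
  have := integrable_ae measurableT ig.
  by apply: filterS => z /(_ Logic.I); rewrite ge0_fin_numE.
have cKZ B C : measurable B -> measurable C ->
    P ((Y @^-1` B) `&` (Z @^-1` C)) = \int[P]_(w in Z @^-1` C) KS (S (Z w)) B.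
  move=> mB mC; rewrite factorization//.
  transitivity (\int[pushforward P Z]_(z in C) KS (S z) B); last first.
    rewrite ge0_integral_pushforward//.
    by apply: measurable_funTS; exact: mKS.
  rewrite [RHS](ge0_integral_density mg g0 gE)//; last exact: mKS.
  apply: ae_eq_integral => //.
  - by apply: measurable_funTS; apply: emeasurable_funM => //; exact: mk.
  - by apply: measurable_funTS; apply: emeasurable_funM => //; exact: mKS.
  apply: filterS g_lty => z gz _.
  have k_le : k (S z) B <= k (S z) setT by apply: le_measure; rewrite ?inE.
  have k_ge0 : 0 <= k (S z) B by [].
  change (a z * k (S z) B = mnormalize (k (S z)) (distribution P Y) B * g z).
  (* Zero mass makes both sides vanish; infinite mass forces [a z] to be 0 because [g z] is finite;
     otherwise the mass in [g] cancels the normalizing constant. *)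
  rewrite /mnormalize; move: gz; rewrite /g; case: ifPn => [/orP[]/eqP kE|].
  - have -> : k (S z) B = 0 by apply/eqP; rewrite eq_le k_ge0 andbT -kE.
    by rewrite kE !mule0.
  - have := a0 z; rewrite kE le_eqVlt => /orP[/eqP <-|az].
      by rewrite !mul0e mule0.
    by rewrite gt0_muley.
  - rewrite negb_or => /andP[kS0 kSy] _.
    have kSfin : k (S z) setT \is a fin_num by rewrite ge0_fin_numE// ltey.
    rewrite -[in RHS](fineK kSfin) muleCA !muleA -[in RHS]muleA -EFinM mulVf ?mule1//.
    by apply: contraNneq kS0 => /= kS0; rewrite -(fineK kSfin) kS0.
split=> //; exists (kprecomp KS mS), KS; split=> //.
- move=> B C mB mC; rewrite comp_preimage; apply: cKZ => //.
  by rewrite -[X in measurable X]setTI; exact: mS.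
- exact: aeW.
Qed.

End Factorization.

(** * Joint density of the three variables on an event that fixes the discrete one *)

Lemma ge0_integral_mrestr d (T : measurableType d) (R : realType)
    (mu : {measure set T -> \bar R}) (D E : set T) (mD : measurable D)
    (f : T -> \bar R) :
  measurable E -> measurable_fun setT f -> (forall x, (0 <= f x)%E) ->
  (\int[mrestr mu mD]_(x in E) f x = \int[mu]_(x in E `&` D) f x)%E.
Proof.
move=> mE mf f0.
rewrite (@ge0_integral_density _ _ _ mu (mrestr mu mD)
  (fun x => (\1_D x)%:E))//; last 2 first.
- exact/measurable_EFinP.
- by move=> A mA; rewrite integral_indic//= setIC.
rewrite integral_mkcondr; apply: eq_integral => x _.
by rewrite patchE indicE; case: ifPn; rewrite ?mule1 ?mule0.
Qed.

Section JointDensity.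
Context d dX dH dY (Omega : measurableType d) (TX : measurableType dX)
  (TH : measurableType dH) (TY : measurableType dY) (R : realType).
Variables (P : probability Omega R).
Variables (X : {RV P >-> TX}) (H : {RV P >-> TH}) (Y : {RV P >-> TY}).
Variables (lambda : {sigma_finite_measure set TX -> \bar R}) (h : TH).
Variables (phi : TX * TY -> \bar R) (pmf : TY -> \bar R).
Hypotheses (mphi : measurable_fun setT phi) (phi0 : forall u, (0 <= phi u)%E).
Hypotheses (mpmf : measurable_fun setT pmf) (pmf0 : forall y, (0 <= pmf y)%E).
Variables (KX : R.-pker (TH * TY) ~> TX) (KH : R.-pker TY ~> TH).
Hypothesis KXP : cond_dist P X (fun w => (H w, Y w)) KX.
Hypothesis KHP : cond_dist P H Y KH.

Local Open Scope ereal_scope.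

Hypothesis mh : measurable [set h].
Hypothesis KXE : forall y B, measurable B ->
  KX (h, y) B = \int[lambda]_(x in B) phi (x, y).
Hypothesis KHE : forall y, KH y [set h] = pmf y.

(** On the event H = h the kernel [KX] depends on [Y] alone, and [P] restricted to that event,
    pushed forward by [Y], has density [pmf] with respect to the law of [Y]. Tonelli then exchanges
    the two integrals. *)
Lemma joint_density (A : set TX) (B : set TY) : measurable A -> measurable B ->
  P (X @^-1` A `&` (H @^-1` [set h] `&` Y @^-1` B)) =
  \int[lambda]_(x in A) \int[distribution P Y]_(y in B) (phi (x, y) * pmf y).
Proof.
move=> mA mB.
have mE : measurable (H @^-1` [set h]) by exact: measurable_sfunP.
have mYB : measurable (Y @^-1` B) by exact: measurable_sfunP.
have mKX : measurable_fun setT (fun y => KX (h, y) A).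
  exact: measurableT_comp (measurable_kernel KX A mA) _.
have preimE : H @^-1` [set h] `&` Y @^-1` B =
    (fun w => (H w, Y w)) @^-1` ([set h] `*` B) by [].
rewrite preimE KXP//; last exact: measurableX.
rewrite -preimE setIC.
transitivity (\int[mrestr P mE]_(w in Y @^-1` B) KX (h, Y w) A).
  rewrite ge0_integral_mrestr//; last exact: measurableT_comp mKX _.
  by apply: eq_integral => w; rewrite inE => -[_ /= ->].
transitivity (\int[pushforward (mrestr P mE) Y]_(y in B) KX (h, y) A).
  by rewrite ge0_integral_pushforward//; exact: measurable_funTS.
rewrite [LHS](@ge0_integral_density _ _ _ (distribution P Y) _ pmf)//; last first.
  move=> C mC; change (P (Y @^-1` C `&` H @^-1` [set h]) =
    \int[distribution P Y]_(y in C) pmf y).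
  rewrite setIC KHP//.
  rewrite ge0_integral_pushforward//; last exact: measurable_funTS.
  by apply: eq_integral => w _; rewrite KHE.
transitivity (\int[distribution P Y]_(y in B)
    \int[lambda]_(x in A) (phi (x, y) * pmf y)).
  apply: eq_integral => y _; rewrite KXE// ge0_integralZr//.
  apply: measurable_funTS; exact: measurableT_comp.
(* The domains [A] and [B] become indicators, so that Tonelli applies on the full product space. *)
pose g u := phi u * pmf u.2 * ((\1_A u.1)%:E * (\1_B u.2)%:E).
have mg : measurable_fun setT g.
  apply: emeasurable_funM.
    by apply: emeasurable_funM => //; exact: measurableT_comp.
  by apply: emeasurable_funM; apply/measurable_EFinP; exact: measurableT_comp.
have g0 u : 0 <= g u by rewrite !mule_ge0.
transitivity (\int[distribution P Y]_y \int[lambda]_x g (x, y)).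
  rewrite integral_mkcond; apply: eq_integral => y _; rewrite patchE.
  case: ifPn => yB; last first.
    by rewrite integral0_eq// => x _; rewrite /g !indicE /= (negbTE yB) !mule0.
  rewrite integral_mkcond; apply: eq_integral => x _.
  rewrite patchE /g !indicE /= yB mule1.
  by case: ifPn; rewrite ?mule1 ?mule0.
rewrite -fubini_tonelli//.
rewrite [RHS]integral_mkcond; apply: eq_integral => x _; rewrite patchE.
case: ifPn => xA; last first.
  by rewrite integral0_eq// => y _; rewrite /g !indicE /= (negbTE xA) !mul0e mule0.
rewrite [RHS]integral_mkcond; apply: eq_integral => y _.
rewrite patchE /g !indicE /= xA mul1e.
by case: ifPn; rewrite ?mule1 ?mule0.
Qed.

End JointDensity.

(** * Boolean tuples as a finite discrete space *)

Lemma measurable_tuple_bool n (A : set (n.-tuple bool)) : measurable A.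
Proof.
have -> : A = \bigcup_(h in A) [set h].
  by apply/seteqP; split=> [h Ah|h [g Ag ->//]]; exists h.
apply: fin_bigcup_measurable => // h _.
have -> : [set h] = \bigcap_(i in [set: 'I_n]) (fun g => tnth g i) @^-1` [set tnth h i].
  apply/seteqP; split=> [g -> //|g hg].
  by apply: eq_from_tnth => i; exact: hg.
apply: fin_bigcap_measurable => // i _.
rewrite -[X in measurable X]setTI.
exact: (@measurable_tnth _ bool _ i).
Qed.

Lemma measurable_slice d (T : measurableType d) n (C : set (T * n.-tuple bool)) h :
  measurable C -> measurable [set x | C (x, h)].
Proof. by move=> mC; rewrite -[X in measurable X]setTI; exact: pair2_measurable. Qed.

(* [zeta] is the product of [lambda] with the counting measure. *)
Lemma slice_sum_measure d (T : measurableType d) (R : realType) n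
    (lambda : {measure set T -> \bar R}) :
  exists zeta : {measure set (T * n.-tuple bool) -> \bar R},
    forall (C : set (T * n.-tuple bool)) (f : T * n.-tuple bool -> \bar R),
    measurable C -> measurable_fun setT f -> (forall z, (0 <= f z)%E) ->
  (\int[zeta]_(z in C) f z =
   \sum_(h : n.-tuple bool) \int[lambda]_(x in [set x | C (x, h)]) f (x, h))%E.
Proof.
pose hs := index_enum {: n.-tuple bool}.
pose h0 : n.-tuple bool := [tuple of nseq n false].
(* One copy of [lambda] is pushed onto each slice. Slices are indexed by the rank of h in the
   enumeration, since [msum] sums over naturals; [h0] is the default of [nth]. *)
pose slice k := fun x : T => (x, nth h0 hs k).
have mslice k : measurable_fun setT (slice k) by exact: measurable_pair2.
pose slice_measure k : {measure set (T * n.-tuple bool) -> \bar R} :=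
  @measure_function_pushforward__canonical__measure_function_Measure
    _ _ _ _ _ lambda (slice k) (mslice k).
exists (msum slice_measure (size hs)) => C f mC mf f0.
rewrite ge0_integral_measure_sum//; last exact: measurable_funTS.
rewrite (big_nth h0) big_mkord; apply: eq_bigr => k _.
rewrite ge0_integral_pushforward//; exact: measurable_funTS.
Qed.

Lemma probability_sum_tuple_bool d (Omega : measurableType d) (R : realType)
    (P : probability Omega R) n (H : {RV P >-> n.-tuple bool}) (E : set Omega) :
  measurable E ->
  P E = (\sum_(h : n.-tuple bool) P (E `&` H @^-1` [set h]))%E.
Proof.
move=> mE; have {1}-> : E = \bigcup_(h in [set: n.-tuple bool]) (E `&` H @^-1` [set h]).
  by apply/seteqP; split=> [w Ew|w [h _ []//]]; exists (H w).
rewrite measure_fin_bigcup//.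
- rewrite [RHS]bigfs ?index_enum_uniq// => [|h _ /negP[]]; last by rewrite mem_index_enum.
  by apply: eq_fsbigl; apply/seteqP; split.
- exact: finite_finset.
- apply/trivIsetP => g h _ _ gh; apply/seteqP; split=> // w [[_ /= Hg] [_ /= Hh]].
  by move: gh; rewrite -Hg -Hh eqxx.
- move=> h _; apply: measurableI => //; apply: measurable_sfunP.
  exact: measurable_tuple_bool.
Qed.

(** * Measurability of matrix-valued functions *)

Section MeasurableMatrix.
Context d (T : measurableType d) (R : realType).

(** The scalars in the densities are entries 0 0 of matrix products, so closure under matrix
    operations gives their measurability directly. *)
Definition measurable_mx m n (F : T -> 'M[R]_(m, n)) : Prop :=
  forall i j, measurable_fun setT (fun x => F x i j).

Lemma measurable_mx_cst m n (M : 'M[R]_(m, n)) : measurable_mx (fun=> M).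
Proof. by move=> i j; exact: measurable_cst. Qed.

Lemma measurable_mxD m n (F G : T -> 'M[R]_(m, n)) :
  measurable_mx F -> measurable_mx G -> measurable_mx (fun x => F x + G x).
Proof.
move=> mF mG i j; under eq_fun do rewrite mxE; exact: measurable_funD.
Qed.

Lemma measurable_mxB m n (F G : T -> 'M[R]_(m, n)) :
  measurable_mx F -> measurable_mx G -> measurable_mx (fun x => F x - G x).
Proof.
move=> mF mG i j; under eq_fun do rewrite !mxE; exact: measurable_funB.
Qed.

Lemma measurable_mxM m n l (F : T -> 'M[R]_(m, n)) (G : T -> 'M[R]_(n, l)) :
  measurable_mx F -> measurable_mx G -> measurable_mx (fun x => F x *m G x).
Proof.
move=> mF mG i j; under eq_fun do rewrite mxE.
by apply: measurable_sum => k; exact: measurable_funM.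
Qed.

Lemma measurable_tr m n (F : T -> 'M[R]_(m, n)) :
  measurable_mx F -> measurable_mx (fun x => (F x)^T).
Proof. by move=> mF i j; under eq_fun do rewrite mxE; exact: mF. Qed.

Lemma measurable_col_mx m1 m2 n (F : T -> 'M[R]_(m1, n)) (G : T -> 'M[R]_(m2, n)) :
  measurable_mx F -> measurable_mx G -> measurable_mx (fun x => col_mx (F x) (G x)).
Proof.
move=> mF mG i j; under eq_fun do rewrite mxE.
by case: (fintype.split i) => k; [exact: mF|exact: mG].
Qed.

Lemma measurable_row_mx m n1 n2 (F : T -> 'M[R]_(m, n1)) (G : T -> 'M[R]_(m, n2)) :
  measurable_mx F -> measurable_mx G -> measurable_mx (fun x => row_mx (F x) (G x)).
Proof.
move=> mF mG i j; under eq_fun do rewrite mxE.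
by case: (fintype.split j) => k; [exact: mF|exact: mG].
Qed.

Lemma measurable_cvec n (F : T -> n.-tuple R) :
  measurable_fun setT F -> measurable_mx (fun x => cvec (F x)).
Proof.
move=> /measurable_fun_tnthP mF i j; under eq_fun do rewrite mxE; exact: mF.
Qed.

(** The space of Boolean tuples is discrete, so [G] is arbitrary; this covers [cvecb] and [vech]
    without unfolding them. *)
Lemma measurable_mx_tuple_bool m n k (F : T -> k.-tuple bool)
    (G : k.-tuple bool -> 'M[R]_(m, n)) :
  measurable_fun setT F -> measurable_mx (fun x => G (F x)).
Proof.
move=> mF i j; apply: (measurableT_comp (f := fun h => G h i j)) => //.
by move=> _ B _; exact: measurable_tuple_bool.
Qed.

End MeasurableMatrix.

(** * Algebra of the exponent *)

Lemma tr_mx11 (R : Type) (N : 'M[R]_1) : N^T 0 0 = N 0 0.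
Proof. by rewrite mxE. Qed.

(** Unlike [mxE], this and [oppmxE] leave matrix products folded, so that [ring] and [field] see
    them as atoms. *)
Lemma addmxE (R : nmodType) m n (N N' : 'M[R]_(m, n)) i j :
  (N + N') i j = N i j + N' i j.
Proof. by rewrite mxE. Qed.

Lemma oppmxE (R : zmodType) m n (N : 'M[R]_(m, n)) i j : (- N) i j = - N i j.
Proof. by rewrite mxE. Qed.

Lemma quadratic_formB (R : comNzRingType) n (Q : 'M[R]_n) (u v : 'cV[R]_n) :
  Q^T = Q ->
  ((u - v)^T *m Q *m (u - v)) 0 0 =
  (u^T *m Q *m u) 0 0 - 2 * (v^T *m Q *m u) 0 0 + (v^T *m Q *m v) 0 0.
Proof.
move=> symQ; have uv : (u^T *m Q *m v) 0 0 = (v^T *m Q *m u) 0 0.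
  by rewrite -[LHS]tr_mx11 !trmx_mul trmxK symQ mulmxA.
have -> : (u - v)^T = u^T - v^T by rewrite raddfB.
by rewrite !mulmxBl !mulmxBr !(addmxE, oppmxE) uv; ring.
Qed.

Section DensityFactorization.
Context (R : realType) (p q r : nat).
Variables (Delta : 'M[R]_p) (A : 'M[R]_(p, r)) (beta : 'M[R]_(p, q)).
Variables (mu_X : 'cV[R]_p) (mu_H : 'cV[R]_q).
Variables (tau0 : 'cV[R]_((q * q.+1)./2)) (tau : 'M[R]_((q * q.+1)./2, r)).

Let Q := invmx Delta.
Let M := red_mx Delta A beta tau.

(** [F] is repeated because both column blocks of [red_mx], the Gaussian one and the Ising one, are
    paired with the same f_y. The row block with -beta^T Delta^-1 A supplies the shift of x by beta
    h. *)
Lemma mulmx_red_mx (F : 'cV[R]_r) (x : p.-tuple R) (h : q.-tuple bool) :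
  (row_mx F^T F^T *m M^T *m wvec (x, h)) 0 0 =
  (F^T *m A^T *m Q^T *m (cvec x - beta *m cvecb h)) 0 0 +
  ((vech (cvecb h *m (cvecb h)^T))^T *m (tau *m F)) 0 0.
Proof.
have -> : ((vech (cvecb h *m (cvecb h)^T))^T *m (tau *m F)) 0 0 =
    (F^T *m (tau^T *m vech (cvecb h *m (cvecb h)^T))) 0 0.
  by rewrite -[RHS]tr_mx11 !trmx_mul !trmxK mulmxA.
rewrite /M /red_mx /wvec /= !tr_col_mx !tr_row_mx !trmx0.
rewrite !mul_mx_row !mul_row_col !mulmx0 addr0 add0r.
have -> : (- (beta^T *m invmx Delta *m A))^T = - (A^T *m Q^T *m beta).
  by rewrite raddfN /= !trmx_mul trmxK mulmxA.
rewrite addr0 trmx_mul !mulmxBr mulmxN mulNmx !mulmxA addrA.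
by rewrite !addmxE.
Qed.

Definition centered_X (x : p.-tuple R) (h : q.-tuple bool) : 'cV[R]_p :=
  cvec x - mu_X - beta *m (cvecb h - mu_H).

Definition base_factor (z : p.-tuple R * q.-tuple bool) : R :=
  let u := centered_X z.1 z.2 in
  (Num.sqrt ((2 * pi) ^+ p * \det Delta))^-1 *
  expR (- ((u^T *m Q *m u) 0 0) / 2 +
    ((vech (cvecb z.2 *m (cvecb z.2)^T))^T *m tau0) 0 0).

(* [l] stands for [row_mx F^T F^T *m M^T *m wvec z]. *)
Definition tilt_factor (l : R) (F : 'cV[R]_r) : R :=
  expR (l - (F^T *m A^T *m Q^T *m (mu_X - beta *m mu_H)) 0 0
        - ((A *m F)^T *m Q *m (A *m F)) 0 0 / 2) /
  \sum_(g : q.-tuple bool) ising_weight (tau0 + tau *m F) g.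

(** Expanding the quadratic form at u - A F leaves the cross term F^T A^T Delta^-1 u. Since u is (x
    - beta h) - (mu_X - beta mu_H), its first part goes into the statistic of [mulmx_red_mx] and its
    second part depends on [F] alone. *)
Lemma density_factorization (x : p.-tuple R) (h : q.-tuple bool) (F : 'cV[R]_r) :
  Delta^T = Delta ->
  multinormal_pdf (mu_X + A *m F + beta *m (cvecb h - mu_H)) Delta x *
    ising_pmf (tau0 + tau *m F) h =
  base_factor (x, h) *
    tilt_factor ((row_mx F^T F^T *m M^T *m wvec (x, h)) 0 0) F.
Proof.
move=> symD; have symQ : Q^T = Q by rewrite /Q trmx_inv symD.
rewrite /multinormal_pdf /ising_pmf /ising_weight /base_factor /tilt_factor /=.
rewrite mulmx_red_mx symQ -/Q; set u := centered_X x h; set v := A *m F.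
have -> : cvec x - (mu_X + v + beta *m (cvecb h - mu_H)) = u - v.
  by rewrite /u /centered_X !opprD !addrA addrAC.
rewrite quadratic_formB//.
have -> : cvec x - beta *m cvecb h = u + (mu_X - beta *m mu_H).
  rewrite /u /centered_X mulmxBr; apply/matrixP => i j.
  by rewrite !(addmxE, oppmxE); ring.
clearbody u; rewrite -trmx_mul -/v; clearbody v; rewrite !mulmxDr !addmxE.
(* The Gaussian constant and the Ising normalizer match; only the identity of exponents remains. *)
rewrite -!mulrA; congr (_ * _); rewrite !mulrA -!expRD; congr (expR _ * _).

by field.
Qed.

End DensityFactorization.

(** * Measurability of the densities and of their factors *)

Lemma measurable_fun_posV d (T : measurableType d) (R : realType) (g : T -> R) :
  measurable_fun setT g -> (forall x, 0 < g x) ->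
  measurable_fun setT (fun x => (g x)^-1).
Proof.
move=> mg g0; rewrite (_ : (fun x => _) = (fun x => expR (- ln (g x)))).
  apply: measurableT_comp => //; apply: measurable_funN.
  by apply: measurableT_comp mg; exact: measurable_ln.
by apply/funext => x; rewrite expRN lnK// posrE.
Qed.

Section MeasurableDensities.
Context d (T : measurableType d) (R : realType) (p q r : nat).

Lemma ising_weight_sum_gt0 (theta : 'cV[R]_((q * q.+1)./2)) :
  0 < \sum_(g : q.-tuple bool) ising_weight theta g.
Proof.
rewrite (bigD1 [tuple of nseq q false])//= ltr_pwDl ?expR_gt0// sumr_ge0// => g _.
exact: expR_ge0.
Qed.

Lemma measurable_ising_weight (theta : T -> 'cV[R]_((q * q.+1)./2)) h :
  measurable_mx theta -> measurable_fun setT (fun x => ising_weight (theta x) h).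
Proof.
move=> mtheta; apply: measurableT_comp => //.
by apply: measurable_mxM => //; exact: measurable_mx_cst.
Qed.

Lemma measurable_ising_weight_sumV (theta : T -> 'cV[R]_((q * q.+1)./2)) :
  measurable_mx theta -> measurable_fun setT
    (fun x => (\sum_(g : q.-tuple bool) ising_weight (theta x) g)^-1).
Proof.
move=> mtheta; apply: measurable_fun_posV => [|x]; last exact: ising_weight_sum_gt0.
by apply: measurable_sum => g; exact: measurable_ising_weight.
Qed.

Lemma measurable_ising_pmf (theta : T -> 'cV[R]_((q * q.+1)./2)) h :
  measurable_mx theta -> measurable_fun setT (fun x => ising_pmf (theta x) h).
Proof.
move=> mtheta; apply: measurable_funM; first exact: measurable_ising_weight.
exact: measurable_ising_weight_sumV.
Qed.

Lemma measurable_multinormal_pdf (m : T -> 'cV[R]_p) (D : 'M[R]_p)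
    (X : T -> p.-tuple R) :
  measurable_mx m -> measurable_fun setT X ->
  measurable_fun setT (fun x => multinormal_pdf (m x) D (X x)).
Proof.
move=> mm mX; apply: measurable_funM; first exact: measurable_cst.
apply: measurableT_comp => //; apply: measurable_funM; last exact: measurable_cst.
apply: measurable_funN.
have mXm : measurable_mx (fun x => cvec (X x) - m x).
  by apply: measurable_mxB => //; exact: measurable_cvec.
apply: measurable_mxM => //; apply: measurable_mxM; last exact: measurable_mx_cst.
exact: measurable_tr.
Qed.

Variables (Delta : 'M[R]_p) (A : 'M[R]_(p, r)) (beta : 'M[R]_(p, q)).
Variables (mu_X : 'cV[R]_p) (mu_H : 'cV[R]_q).
Variables (tau0 : 'cV[R]_((q * q.+1)./2)) (tau : 'M[R]_((q * q.+1)./2, r)).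

Lemma measurable_tilt_factor (l : T -> R) (F : T -> 'cV[R]_r) :
  measurable_fun setT l -> measurable_mx F ->
  measurable_fun setT
    (fun x => tilt_factor Delta A beta mu_X mu_H tau0 tau (l x) (F x)).
Proof.
move=> ml mF; have mAF : measurable_mx (fun x => A *m F x).
  by apply: measurable_mxM => //; exact: measurable_mx_cst.
apply: measurable_funM; last first.
  apply: measurable_ising_weight_sumV.
  apply: measurable_mxD; first exact: measurable_mx_cst.
  by apply: measurable_mxM => //; exact: measurable_mx_cst.
apply: measurableT_comp => //; apply: measurable_funB.
  apply: measurable_funB => //.
  do 3 (apply: measurable_mxM; last exact: measurable_mx_cst).
  exact: measurable_tr.
apply: measurable_funM; last exact: measurable_cst.
apply: measurable_mxM => //; apply: measurable_mxM; last exact: measurable_mx_cst.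
exact: measurable_tr.
Qed.

Lemma measurable_base_factor : measurable_fun setT
  (base_factor Delta beta mu_X mu_H tau0 : p.-tuple R * q.-tuple bool -> R).
Proof.
apply: measurable_funM; first exact: measurable_cst.
apply: measurableT_comp => //; apply: measurable_funD.
  apply: measurable_funM; last exact: measurable_cst.
  apply: measurable_funN.
  pose u (z : p.-tuple R * q.-tuple bool) := centered_X beta mu_X mu_H z.1 z.2.
  have mu : measurable_mx u.
    apply: measurable_mxB.
      apply: measurable_mxB; last exact: measurable_mx_cst.
      exact: measurable_cvec.
    exact: (measurable_mx_tuple_bool (F := snd)
      (fun h : q.-tuple bool => beta *m (cvecb h - mu_H)) measurable_snd).
  apply: (measurable_mxM (F := fun z => (u z)^T *m invmx Delta)) => //.
  apply: measurable_mxM; last exact: measurable_mx_cst.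
  exact: measurable_tr.
exact: (measurable_mx_tuple_bool (F := snd) (fun h : q.-tuple bool =>
  (vech (@cvecb R q h *m (cvecb h)^T))^T *m tau0) measurable_snd).
Qed.

End MeasurableDensities.

(** * The model satisfies the factorization criterion *)

Theorem corollary5 (R : realType) (d dY : measure_display)
    (Omega : measurableType d) (TY : measurableType dY)
    (P : probability Omega R) (p q r : nat)
    (Y : {RV P >-> TY}) (X : {RV P >-> p.-tuple R}) (H : {RV P >-> q.-tuple bool})
    (f : {mfun TY >-> r.-tuple R})
    (Delta : 'M[R]_p) (A : 'M[R]_(p, r)) (beta : 'M[R]_(p, q))
    (mu_X : 'cV[R]_p) (mu_H : 'cV[R]_q)
    (tau0 : 'cV[R]_((q * q.+1)./2)) (tau : 'M[R]_((q * q.+1)./2, r))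
    (model : mixed_normal_ising Y X H f Delta A beta mu_X mu_H tau0 tau)
    (m : nat) (alpha_c : 'M[R]_(p + (q + (q * q.+1)./2), m))
    (basis : cols_basis_of_span alpha_c (red_mx Delta A beta tau)) :
  let Z := fun w => (X w, H w) in
  sufficient_reduction P Y Z
    (reduction alpha_c (expectation_cV P (fun w => wvec (Z w)))).
Proof.
move=> Z; set Ew := expectation_cV _ _.
have [[symD _] _ _ _ [KX KXP KXE] [KH KHP KHE]] := model.
pose M := red_mx Delta A beta tau.
pose S := reduction alpha_c Ew.
(* The rows of M^T lie in the row space of alpha_c^T, so the pseudo-inverse gives the coefficients
   expressing them there. *)
pose C := M^T *m pinvmx alpha_c^T.
have MC : M^T = C *m alpha_c^T.
  by rewrite mulmxKpV// basis.2.
(* Adding alpha_c^T Ew undoes the centering: the bilinear term of the exponent is recovered from the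
   value s of the reduction. *)
pose stat (F : 'cV[R]_r) (s : m.-tuple R) :=
  (row_mx F^T F^T *m C *m (cvec s + alpha_c^T *m Ew)) 0 0.
have statE F z : stat F (S z) = (row_mx F^T F^T *m M^T *m wvec z) 0 0.
  rewrite /stat; have -> : cvec (S z) = alpha_c^T *m (wvec z - Ew).
    by apply/matrixP => i j; rewrite (ord1 j) mxE tnth_mktuple.
  by rewrite -mulmxDr subrK MC !mulmxA.
have mZ : measurable_fun setT Z by exact: measurable_fun_pair.
have mx1 (d1 : measure_display) (T1 : measurableType d1) :
    measurable_mx (fun u : p.-tuple R * T1 => cvec u.1) by exact: measurable_cvec.
have mwvec : measurable_mx (wvec (R := R) (p := p) (q := q)).
  apply: measurable_col_mx; first exact: mx1.
  apply: measurable_col_mx.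
    exact: (measurable_mx_tuple_bool (F := snd) (@cvecb R q) measurable_snd).
  exact: (measurable_mx_tuple_bool (F := snd) (fun h : q.-tuple bool =>
    vech (@cvecb R q h *m (cvecb h)^T)) measurable_snd).
have mS : measurable_fun setT S.
  apply/measurable_fun_tnthP => i.
  rewrite (_ : _ \o _ = fun z => (alpha_c^T *m (wvec z - Ew)) i 0); last first.
    by apply/funext => z /=; rewrite tnth_mktuple.
  apply: measurable_mxM; first exact: measurable_mx_cst.
  by apply: measurable_mxB => //; exact: measurable_mx_cst.
pose a z := (base_factor Delta beta mu_X mu_H tau0 z)%:E.
pose t (u : m.-tuple R * TY) := (tilt_factor Delta A beta mu_X mu_H tau0 tau
  (stat (cvec (f u.2)) u.1) (cvec (f u.2)))%:E.
have a0 z : (0 <= a z)%E.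
  by rewrite lee_fin mulr_ge0 ?expR_ge0// invr_ge0 sqrtr_ge0.
have t0 u : (0 <= t u)%E.
  rewrite lee_fin mulr_ge0 ?expR_ge0// invr_ge0 sumr_ge0// => g _.
  exact: expR_ge0.
have ma : measurable_fun setT a.
  by apply/measurable_EFinP; exact: measurable_base_factor.
have mfS (F : m.-tuple R * TY -> 'cV[R]_r) :
    measurable_mx F -> measurable_fun setT (fun u => stat (F u) u.1).
  move=> mF; have mFT : measurable_mx (fun u => (F u)^T) by exact: measurable_tr.
  apply: measurable_mxM.
    apply: measurable_mxM; first exact: measurable_row_mx.
    exact: measurable_mx_cst.
  by apply: measurable_mxD; [exact: measurable_cvec|exact: measurable_mx_cst].
have mt : measurable_fun setT t.
  have mf2 : measurable_mx (fun u : m.-tuple R * TY => cvec (f u.2)).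
    by apply: measurable_cvec; exact: measurableT_comp.
  apply/measurable_EFinP; apply: measurable_tilt_factor => //; exact: mfS.
have [zeta zetaE] := slice_sum_measure q (lebesgue_tuple R p).
apply: (@factorization_sufficient_reduction _ _ _ _ _ _ _ _ _ _ _ _ zeta S a t) => //.
move=> B D mB mD; rewrite zetaE//; last 2 first.
- apply: emeasurable_funM => //.
  (* This is the measurability of the kernel [kdensity] in its source variable. *)
  have mtS : measurable_fun setT (fun s => \int[distribution P Y]_(y in B) t (s, y))%E.
    exact: (measurable_kernel (kdensity (distribution P Y) mt t0) B mB).
  exact: measurableT_comp mtS mS.
- by move=> z; rewrite mule_ge0// integral_ge0.
have mYB : measurable (Y @^-1` B) by exact: measurable_sfunP.
have mZD : measurable (Z @^-1` D).
  by rewrite -[X in measurable X]setTI; exact: mZ.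
(* Both sides are now sums over the values h of [H], compared term by term; on H = h the event Z in
   D says that [X] lies in the slice of D at h. *)
rewrite (probability_sum_tuple_bool H); last exact: measurableI.
apply: eq_bigr => h _.
have -> : Y @^-1` B `&` Z @^-1` D `&` H @^-1` [set h] =
    X @^-1` [set x | D (x, h)] `&` (H @^-1` [set h] `&` Y @^-1` B).
  apply/seteqP; split=> w /=; rewrite /Z /=; first by case=> -[? +] <-.
  by move=> [Dw [Hw Bw]]; rewrite Hw.
pose phi (u : p.-tuple R * TY) :=
  (multinormal_pdf (mu_X + A *m cvec (f u.2) + beta *m (cvecb h - mu_H))
    Delta u.1)%:E.
pose pmf y := (ising_pmf (tau0 + tau *m cvec (f y)) h)%:E.
rewrite (@joint_density _ _ _ _ _ _ _ _ _ _ _ _ _ (lebesgue_tuple R p) h phi pmf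
   _ _ _ _ _ _ KXP KHP)//.
- apply: eq_integral => x _.
  (* Once a(x, h) is moved under the integral over y, the integrands agree pointwise. *)
  rewrite -ge0_integralZl//.
  + apply: eq_integral => y _.
    by rewrite /phi /pmf /a /t -!EFinM density_factorization//= statE.
  + by apply: measurable_funTS; exact: measurableT_comp.
- apply/measurable_EFinP; apply: measurable_multinormal_pdf => //.
  apply: measurable_mxD; last exact: measurable_mx_cst.
  apply: measurable_mxD; first exact: measurable_mx_cst.
  apply: measurable_mxM; first exact: measurable_mx_cst.
  by apply: measurable_cvec; exact: measurableT_comp.
- by move=> u; rewrite lee_fin mulr_ge0 ?expR_ge0// invr_ge0 sqrtr_ge0.
- apply/measurable_EFinP; apply: measurable_ising_pmf.
  apply: measurable_mxD; first exact: measurable_mx_cst.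
  apply: measurable_mxM; first exact: measurable_mx_cst.
  exact: measurable_cvec.
- move=> y; rewrite lee_fin mulr_ge0 ?expR_ge0// invr_ge0 ltW//.
  exact: ising_weight_sum_gt0.
- exact: measurable_tuple_bool.
- by move=> y G mG; rewrite KXE.
- exact: measurable_slice.
Qed.
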